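(* For all nonnegative integers $a \leq b$, $\mathcal{G}_{\mathcal{E}}(a,b) \leq a+b$.
   Context: A position is an unordered pair $(a,b)$ of nonnegative integers (pile sizes). $\mathcal{E}$-Wythoff: a move either removes a positive number of tokens from one pile, or removes the same positive number of tokens from both piles, or removes $k$ tokens from the smaller pile (or from either pile if the piles are equal) and $l$ tokens from the other pile, for integers $k \geq 1$, $l\ge 0$ with $l < k$. $\mathcal{G}_{\mathcal{E}}$ is its Sprague-Grundy function: $\mathcal{G}_{\mathcal{E}}(p)=\mathrm{mex}\{\mathcal{G}_{\mathcal{E}}(q): q \text{ reachable from } p \text{ in one move}\}$, where $\mathrm{mex}(S)$ is the least nonnegative integer not in $S$ and $\mathrm{mex}\{\}=0$. *)

(* Defs.v *)
From mathcomp Require Import all_boot.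

Set Implicit Arguments.
Unset Strict Implicit.
Unset Printing Implicit Defensive.

Fact mex_subproof (s : seq nat) : exists n, n \notin s.
Proof.
exists (\max_(i <- s) i).+1; apply/negP => ins.
by have := @leq_bigmax_seq _ s xpredT id _ ins isT; rewrite ltnn.
Qed.

Definition mex (s : seq nat) : nat := ex_minn (mex_subproof s).

(* The unordered pair {a, b} is represented by either of the ordered pairs    *)
(* (a, b) and (b, a): the moves are invariant under swapping the two piles    *)
(* (move_swap), hence so is the Sprague-Grundy function (grundyC).            *)
Definition position : Type := (nat * nat)%type.

Inductive move : position -> position -> Prop :=
| MoveLeft a b k of 0 < k & k <= a : move (a, b) (a - k, b)
| MoveRight a b k of 0 < k & k <= b : move (a, b) (a, b - k)
| MoveDiag a b k of 0 < k & k <= a & k <= b : move (a, b) (a - k, b - k)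
| MoveExtraLeft a b k l of a <= b & 0 < k & l < k & k <= a & l <= b :
    move (a, b) (a - k, b - l)
| MoveExtraRight a b k l of b <= a & 0 < k & l < k & k <= b & l <= a :
    move (a, b) (a - l, b - k).

Definition options (p : position) : seq position :=
  let: (a, b) := p in
     [seq (a - k, b) | k <- iota 1 a]
  ++ [seq (a, b - k) | k <- iota 1 b]
  ++ [seq (a - k, b - k) | k <- iota 1 (minn a b)]
  ++ (if a <= b then [seq (a - k, b - l) | k <- iota 1 a, l <- iota 0 k]
      else [::])
  ++ (if b <= a then [seq (a - l, b - k) | k <- iota 1 b, l <- iota 0 k]
      else [::]).

Lemma optionsP (p q : position) : reflect (move p q) (q \in options p).
Proof.
apply: (iffP idP) => [|mv].
  case: p => a b.
  rewrite !mem_cat => /or4P[/mapP[k]|/mapP[k]|/mapP[k]|].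
  - by rewrite mem_iota add1n ltnS => /andP[? ?] ->; constructor.
  - by rewrite mem_iota add1n ltnS => /andP[? ?] ->; constructor.
  - rewrite mem_iota add1n ltnS leq_min => /and3P[? ? ?] ->.
    by constructor.
  case/orP; case: ifP => // leab /allpairsPdep[k [l []]];
    rewrite !mem_iota add1n ltnS add0n => /andP[k0 kle] /= lk ->;
    constructor=> //; apply: leq_trans (ltnW lk) (leq_trans kle leab).
case: mv => a b k.
- move=> k0 ka; rewrite !mem_cat; apply/or4P/Or41/mapP; exists k => //.
  by rewrite mem_iota add1n ltnS k0.
- move=> k0 kb; rewrite !mem_cat; apply/or4P/Or42/mapP; exists k => //.
  by rewrite mem_iota add1n ltnS k0.
- move=> k0 ka kb; rewrite !mem_cat; apply/or4P/Or43/mapP; exists k => //.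
  by rewrite mem_iota add1n ltnS leq_min k0 ka.
- move=> l leab k0 lk ka _; rewrite !mem_cat; apply/or4P/Or44; rewrite leab.
  apply/orP; left; apply/allpairsPdep; exists k, l.
  by rewrite !mem_iota add1n ltnS k0.
- move=> l leba k0 lk kb _; rewrite !mem_cat; apply/or4P/Or44; rewrite leba.
  apply/orP; right; apply/allpairsPdep; exists k, l.
  by rewrite !mem_iota add1n ltnS k0.
Qed.

(* The total number of tokens drops at every move, so it bounds the depth of  *)
(* the recursion; grundyE is the defining equation.                           *)
Fixpoint grundy_rec (n : nat) (p : position) : nat :=
  if n is n'.+1 then mex [seq grundy_rec n' q | q <- options p] else 0.

Definition grundy (p : position) : nat := grundy_rec (p.1 + p.2).+1 p.

Lemma move_lt (p q : position) : move p q -> q.1 + q.2 < p.1 + p.2.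
Proof.
have sub_lt k m : 0 < k -> k <= m -> m - k < m.
  by move=> k0 km; rewrite ltn_subrL k0 (leq_trans k0 km).
case=> a b k => [k0 ka|k0 kb|k0 ka kb|l _ k0 _ ka _|l _ k0 _ kb _] /=.
- by rewrite ltn_add2r sub_lt.
- by rewrite ltn_add2l sub_lt.
- by rewrite -addSn leq_add ?leq_subr ?sub_lt.
- by rewrite -addSn leq_add ?leq_subr ?sub_lt.
- by rewrite -addnS leq_add ?leq_subr ?sub_lt.
Qed.

Lemma grundy_recE (n : nat) (p : position) :
  p.1 + p.2 < n -> grundy_rec n p = grundy p.
Proof.
have indep m n' p' : p'.1 + p'.2 < m -> p'.1 + p'.2 < n' ->
    grundy_rec m p' = grundy_rec n' p'.
  elim: m n' p' => [|m IHm] [|n'] p' //= pm pn; congr mex.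
  apply/eq_in_map => q /optionsP/move_lt lt_qp.
  by apply: IHm; apply: leq_trans lt_qp _.
by move=> pn; apply: indep.
Qed.

Lemma grundyE (p : position) :
  grundy p = mex [seq grundy q | q <- options p].
Proof.
rewrite {1}/grundy /=; congr mex.
by apply/eq_in_map => q /optionsP/move_lt; apply: grundy_recE.
Qed.

Lemma move_swap (p q : position) :
  move p q -> move (p.2, p.1) (q.2, q.1).
Proof. by case=> *; constructor. Qed.

Lemma eq_mex (s t : seq nat) : s =i t -> mex s = mex t.
Proof. by move=> st; apply: eq_ex_minn => n; rewrite st. Qed.

Lemma grundyC (a b : nat) : grundy (a, b) = grundy (b, a).
Proof.
suff swap n p : p.1 + p.2 < n -> grundy p = grundy (p.2, p.1).
  exact: (swap _ (a, b) (ltnSn _)).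
elim: n p => // n IHn p pn; rewrite !grundyE; apply: eq_mex => m.
apply/mapP/mapP => -[q /optionsP mv ->]; exists (q.2, q.1).
- exact/optionsP/move_swap.
- by apply: IHn; apply: leq_trans (move_lt mv) _.
- by apply/optionsP; move: (move_swap mv); case: (p).
- have /= := move_lt mv; rewrite (addnC p.2) => lt_qp.
  by apply: IHn; apply: leq_trans lt_qp _.
Qed.

(* Main.v *)
(* Every move lowers the total number of tokens, so inductively every option  *)
(* of (a, b) has a value below a + b; hence a + b itself is an excluded value *)
(* and bounds the mex.                                                        *)
Require Import Defs.
From mathcomp Require Import all_boot.

(** A Grundy value never exceeds a rank that strictly decreases along moves; by [move_lt] the total
    number of tokens is such a rank. [mex_le] turns a value missed by all options into a bound, and
    [grundy_le_total] runs the induction. *)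

Lemma mex_le (s : seq nat) (n : nat) : n \notin s -> mex s <= n.
Proof. by rewrite /mex; case: ex_minnP => m _ min_m /min_m. Qed.

Lemma grundy_le_total (p : position) : grundy p <= p.1 + p.2.
Proof.
have [n] := ubnP (p.1 + p.2); elim: n p => // n IHn p le_pn.
(* An option [q] whose value is the total of [p] would, by induction, have a total at least that of
   [p], against [move_lt]. *)
rewrite grundyE; apply/mex_le/mapP => -[q /optionsP/move_lt lt_qp eq_pq].
have := IHn q (leq_trans lt_qp le_pn).
by rewrite -eq_pq leqNgt lt_qp.
Qed.

Theorem theorem3p8 (a b : nat) (leab : a <= b) : grundy (a, b) <= a + b.
Proof. exact: (grundy_le_total (a, b)). Qed.
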